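(* Let $n,m\ge1$. For every generic distribution $D$ over profiles of $n$ (not necessarily XOS) valuations on the item set $[m]$ there exist $(1/2)$-median prices, i.e. there is a price vector $\mathbf{p}\in\mathbb{R}_{\ge0}^m$ such that $\pi_j(\mathbf{p})\le 1/2$ for every $j\in[m]$ and $\pi_j(\mathbf{p})\ge 1/2$ for every $j\in[m]$ with $p_j>0$.
   Context: Valuations are functions $v:2^{[m]}\to\mathbb{R}_{\ge0}$ with $v(\emptyset)=0$ that are monotone ($v(S)\le v(T)$ for $S\subseteq T$). Demand: for $\mathbf{p}\in\mathbb{R}_{\ge0}^m$ and $M\subseteq[m]$, $\mathcal{D}(v,\mathbf{p},M)$ is the set of all $B\subseteq M$ maximizing $v(B)-\sum_{j\in B}p_j$ over subsets of $M$. Generic: a distribution $D_i$ over valuations is generic if for every $\mathbf{p}\in\mathbb{R}_{\ge0}^m$ and $M\subseteq[m]$, $\mathcal{D}(v_i,\mathbf{p},M)$ contains only one set with probability one over $v_i\sim D_i$. A distribution $D$ over profiles $\mathbf{v}=(v_1,\dots,v_n)$ is generic if each agent's marginal distribution is generic ($D$ need not be a product distribution). Sequential sale at prices $\mathbf{p}$: buyers $1,\dots,n$ arrive in this order; buyer $i$ buys a set $X_i\in\mathcal{D}(v_i,\mathbf{p},M_i)$ where $M_i=[m]\setminus(X_1\cup\dots\cup X_{i-1})$ (almost surely unique for generic $D$). $\pi_j(\mathbf{p})$ is the probability over $\mathbf{v}\sim D$ that item $j$ is sold. *)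

(* Defs.v *)
From HB Require Import structures.
From mathcomp Require Import all_boot all_order all_algebra.
From mathcomp Require Import all_classical all_reals all_analysis.

Set Implicit Arguments.
Unset Strict Implicit.
Unset Printing Implicit Defensive.

Import Order.TTheory GRing.Theory Num.Theory.

Local Open Scope classical_set_scope.
Local Open Scope ring_scope.

Record valuation (R : realType) (m : nat) := Valuation {
  value :> {set 'I_m} -> R;
  value_ge0 : forall S, 0 <= value S;
  value_set0 : value finset.set0 = 0;
  value_mono : forall S T : {set 'I_m}, S \subset T -> value S <= value T }.

Section valuation_measurable.
Context {R : realType} {m : nat}.

HB.instance Definition _ := gen_eqMixin (valuation R m).
HB.instance Definition _ := gen_choiceMixin (valuation R m).

Definition zero_valuation : valuation R m :=
  @Valuation R m (fun=> 0) (fun=> lexx 0) erefl (fun _ _ _ => lexx 0).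

HB.instance Definition _ := isPointed.Build (valuation R m) zero_valuation.

(* Generators of the trace on valuations of the Borel sigma-algebra of
   R ^ (2 ^ m). *)
Definition value_cylinders : set (set (valuation R m)) :=
  \bigcup_(S in [set: {set 'I_m}])
    preimage_set_system [set: valuation R m] (fun v => v S) measurable.

HB.instance Definition _ :=
  @isMeasurable.Build (sigma_display value_cylinders) (valuation R m)
    <<s value_cylinders >> (@sigma_algebra0 _ setT value_cylinders)
    (@sigma_algebraC _ value_cylinders)
    (@sigma_algebra_bigcup _ setT value_cylinders).

End valuation_measurable.

(* The tuple type carries the product sigma-algebra; a distribution over
   profiles is any probability on it, so the agents may be correlated. *)
Notation profile R n m := (n.-tuple (valuation R m)).

Section sequential_sale.
Context {R : realType} {n m : nat}.
Implicit Types (p : 'I_m -> R) (M : {set 'I_m}) (j : 'I_m).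

Definition utility (v : valuation R m) p (B : {set 'I_m}) : R :=
  v B - \sum_(j in B) p j.

Definition demand (v : valuation R m) p M : {set {set 'I_m}} :=
  [set B : {set 'I_m} | (B \subset M) &&
    [forall C : {set 'I_m}, (C \subset M) ==> (utility v p C <= utility v p B)]]%SET.

Definition generic_valuation (Di : probability (valuation R m) R) :=
  forall p M, (forall j, 0 <= p j) ->
    Di [set v | #|demand v p M| = 1%N] = 1%E.

Definition agent (i : 'I_n) (v : profile R n m) : valuation R m := tnth v i.

Lemma measurable_agent i : measurable_fun [set: profile R n m] (agent i).
Proof. exact: measurable_tnth. Qed.

HB.instance Definition _ i :=
  isMeasurableFun.Build _ _ _ _ (agent i) (measurable_agent i).

Definition generic (D : probability (profile R n m) R) :=
  forall i : 'I_n, generic_valuation (distribution D (agent i)).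

Definition remaining (X : 'I_n -> {set 'I_m}) (i : 'I_n) : {set 'I_m} :=
  (~: \bigcup_(k < n | (k < i)%N) X k)%SET.

(* X is a possible run of the sale.  For a generic distribution it is almost
   surely unique, so the probability of sold does not depend on how buyers break
   ties in their demand. *)
Definition sale (v : profile R n m) p (X : 'I_n -> {set 'I_m}) :=
  forall i, X i \in demand (agent i v) p (remaining X i).

Definition sold p j : set (profile R n m) :=
  [set v | exists2 X, sale v p X & exists i, j \in X i].

Definition sale_probability (D : probability (profile R n m) R) p j : \bar R :=
  D (sold p j).

Definition half_median_prices (D : probability (profile R n m) R) p :=
  [/\ forall j, 0 <= p j,
      forall j, (sale_probability D p j <= (1 / 2)%:E)%E &
      forall j, 0 < p j -> ((1 / 2)%:E <= sale_probability D p j)%E].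

End sequential_sale.

(* Main.v *)
Require Import Defs.
From mathcomp Require Import all_boot all_order all_algebra.
From mathcomp Require Import all_classical all_reals all_analysis.
From mathcomp Require Import measurable_realfun lebesgue_integral.
From mathcomp Require Import ring lra.

(* For a generic distribution the sale probabilities are continuous in the
   prices: almost surely every demanded set beats its competitors by a positive
   margin, and on the event that all margins exceed [d] the sale is unaffected
   by price changes that are small compared with [d].  At a sufficiently high
   price an item is sold with probability less than 1/2.  Hence [pi_j - 1/2] is
   a continuous map on a large box of prices, nonpositive where [p_j] is maximal,
   and the complementarity problem for it is solved by a Poincare-Miranda
   argument.  The discrete form of the latter comes from the cubical mod 2
   cochain [d phi_1 \cup ... \cup d phi_m], where [phi_j] is 1 on the face
   [x_j = 0] and 0 on the opposite face: by telescoping, its values on the cubes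
   of the grid add up to 1, so on some cube every [phi_j] takes both values. *)

Set Implicit Arguments.
Unset Strict Implicit.
Unset Printing Implicit Defensive.
Import Order.TTheory GRing.Theory Num.Theory.
Import numFieldNormedType.Exports.
Local Open Scope classical_set_scope.
Local Open Scope ring_scope.

(** * A discrete Poincare-Miranda theorem *)

Lemma addrr_bool (a : bool) : a + a = 0.
Proof. by case: a. Qed.

(** * Cup products of coboundaries mod 2 *)

Section cup_product.
Variables (m : nat) (T : Type) (s : 'I_m -> T -> T).
Hypothesis sC : forall d e x, s d (s e x) = s e (s d x).
Implicit Types (S : {set 'I_m}) (L : seq (T -> bool)).

(* The mod 2 cubical cochain [df1 \cup ... \cup dfk], evaluated on the cube
   based at [x] and spanned by the directions in [S]: a sum over the monotone
   edge paths of the cube. *)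
Fixpoint cup L S (x : T) : bool :=
  if L is f :: L' then
    \sum_(d in S) (f (s d x) + f x) * cup L' (S :\ d) (s d x)
  else 1.

(** The terms at [(d, e)] and [(e, d)] are equal and cancel mod 2. *)
Lemma sum_offdiag_sym S (g : 'I_m -> 'I_m -> bool) :
  (forall d e, g d e = g e d) -> \sum_(d in S) \sum_(e in S :\ d) g d e = 0.
Proof.
move=> gC.
have -> : \sum_(d in S) \sum_(e in S :\ d) g d e =
  \sum_(d in S) \sum_(e in S | (d < e)%N) g d e +
  \sum_(d in S) \sum_(e in S | (e < d)%N) g d e.
  rewrite -big_split /=; apply: eq_bigr => d _.
  rewrite (bigID (fun e : 'I_m => (d < e)%N)) /=; congr (_ + _);
    apply: eq_bigl => e; rewrite !inE -val_eqE /=; case: (ltngtP e d) => //=;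
    by rewrite ?andbT ?andbF.
suff -> : \sum_(d in S) \sum_(e in S | (d < e)%N) g d e =
    \sum_(d in S) \sum_(e in S | (e < d)%N) g d e by exact: addrr_bool.
rewrite [LHS](exchange_big_dep (mem S)) /=; last by move=> d e _ /andP[].
apply: eq_bigr => e eS; rewrite eS.
by apply: eq_big => d //=.
Qed.

(** A product of coboundaries is a cocycle: its values on the front and back facets of a cube cancel
    mod 2. By induction on [L], both sides reduce to the same double sum once the parts symmetric in
    the two directions vanish. *)
Lemma cup_closed L S x :
  \sum_(d in S) cup L (S :\ d) (s d x) = \sum_(d in S) cup L (S :\ d) x.
Proof.
elim: L S x => [//|f L IH] S x /=.
have setD1C d e : S :\ d :\ e = S :\ e :\ d.
  by apply/setP => i; rewrite !inE andbCA.
have swap (g : 'I_m -> 'I_m -> bool) :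
    \sum_(d in S) \sum_(e in S :\ d) g d e =
    \sum_(d in S) \sum_(e in S :\ d) g e d.
  rewrite [LHS](exchange_big_dep (mem S)) /=; last by move=> d e _ /setD1P[].
  apply: eq_bigr => e eS; apply: eq_bigl => d.
  by rewrite !inE eS andbT eq_sym andbC.
transitivity (\sum_(d in S) \sum_(e in S :\ d)
    f (s d x) * cup L (S :\ d :\ e) (s d x)).
  transitivity (\sum_(d in S) \sum_(e in S :\ d)
      f (s e (s d x)) * cup L (S :\ d :\ e) (s e (s d x)) +
    \sum_(d in S) \sum_(e in S :\ d)
      f (s d x) * cup L (S :\ d :\ e) (s e (s d x))).
    rewrite -big_split; apply: eq_bigr => d _ /=; rewrite -big_split.
    by apply: eq_bigr => e _; rewrite mulrDl.
  rewrite sum_offdiag_sym ?add0r; last by move=> d e; rewrite setD1C sC.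
  by apply: eq_bigr => d _; rewrite -!mulr_sumr IH.
symmetry.
transitivity (\sum_(d in S) \sum_(e in S :\ d)
      f (s e x) * cup L (S :\ d :\ e) (s e x) +
    \sum_(d in S) \sum_(e in S :\ d)
      f x * cup L (S :\ d :\ e) (s e x)).
  rewrite -big_split; apply: eq_bigr => d _ /=; rewrite -big_split.
  by apply: eq_bigr => e _; rewrite mulrDl.
rewrite [X in _ + X](_ : _ = 0) ?addr0.
  rewrite swap; apply: eq_bigr => d _; apply: eq_bigr => e _.
  by rewrite setD1C.
transitivity (f x * \sum_(d in S) \sum_(e in S :\ d) cup L (S :\ d :\ e) x).
  rewrite mulr_sumr; apply: eq_bigr => d _.
  by rewrite -mulr_sumr IH.
by rewrite sum_offdiag_sym ?mulr0 // => d e; rewrite setD1C.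
Qed.

End cup_product.

(** * Cubes of a grid and vertex labels *)

Section grid.
Variables (m N : nat).
Local Notation grid := {ffun 'I_m -> 'I_N.+1}.
Implicit Types (S : {set 'I_m}) (x y : grid) (d j : 'I_m).

(* The shift is cyclic, hence a permutation of the grid; on the cubes with
   corner in [base [set: 'I_m]] it never wraps around. *)
Definition shift d x : grid := [ffun j => if j == d then ordS (x j) else x j].

Lemma shiftC d e x : shift d (shift e x) = shift e (shift d x).
Proof.
by apply/ffunP => j; rewrite !ffunE; case: (j == d); case: (j == e).
Qed.

Lemma shift_inj d : injective (shift d).
Proof.
move=> x y /ffunP xy; apply/ffunP => j; have := xy j; rewrite !ffunE.
by case: eqP => // _ /ordS_inj.
Qed.

Lemma ordS_eq0 (i : 'I_N.+1) : (ordS i == ord0) = (i == ord_max).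
Proof.
rewrite -!val_eqE /=; have := ltn_ord i; rewrite ltnS leq_eqVlt.
case/orP => [/eqP -> | iN]; first by rewrite modnn !eqxx.
by rewrite modn_small ?ltnS // (ltn_eqF iN).
Qed.

(** Lower corners of the unit cubes that fill the face of the box spanned by [S] at the origin. *)
Definition base S x :=
  [forall j, if j \in S then x j != ord_max else x j == ord0].

(** The vertices [y] of the cube with corner [x] and directions [S]. *)
Definition near_base S x y :=
  forall j, y j = x j \/ (j \in S) && (y j == ordS (x j)).

Variable phi : 'I_m -> grid -> bool.
Hypothesis phi0 : forall j x, x j = ord0 -> phi j x = 1.
Hypothesis phiN : forall j x, x j = ord_max -> phi j x = 0.
Let phis (L : seq 'I_m) := map phi L.

(** The whole cube lies in a face on which [phi d] is constant, so the factor coming from [phi d]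
    vanishes along every edge path. *)
Lemma cup_face L S x d : d \in L -> d \notin S ->
  x d = ord0 \/ x d = ord_max -> cup shift (phis L) S x = 0.
Proof.
elim: L S x => // a L IH S x dL dS xd /=; rewrite big1 // => e eS.
have ed : d == e = false by apply/negbTE; apply: contraNneq dS => ->.
move: dL; rewrite inE => /predU1P[<-|dL].
  suff -> : phi d (shift e x) = phi d x by rewrite addrr_bool mul0r.
  by case: xd => xd; [rewrite !phi0 | rewrite !phiN] => //; rewrite ffunE ed.
rewrite IH ?mulr0 //; first by rewrite !inE (negbTE dS) andbF.
by rewrite ffunE ed.
Qed.

(** Telescoping in direction [d]: the layers strictly between the two ends are counted twice and
    cancel, and [h] vanishes on the last layer, so only [x d = ord0] remains. *)
Lemma sum_shift S d (h : grid -> bool) : d \in S ->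
    (forall y, y d = ord_max -> h y = 0) ->
  \sum_(x | base S x) h (shift d x) + \sum_(x | base S x) h x =
  \sum_(x | base (S :\ d) x) h x.
Proof.
move=> dS hN.
(* [Q] is the condition of [base S] with the coordinate [d] left free, hence invariant under
   [shift d]. *)
pose Q x := [forall j, (j != d) ==>
  if j \in S then x j != ord_max else x j == ord0].
have baseQ x : base S x = Q x && (x d != ord_max).
  apply/forallP/andP => [H | [/forallP H xd] j].
    split; first by apply/forallP => j; rewrite H implybT.
    by have := H d; rewrite dS.
  by have := H j; case: eqP => [->|]; rewrite ?dS.
have baseD x : base (S :\ d) x = Q x && (x d == ord0).
  apply/forallP/andP => [H | [/forallP H xd] j].
    split; first by apply/forallP => j; have := H j; rewrite !inE; case: eqP.
    by have := H d; rewrite !inE eqxx.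
  by have := H j; rewrite !inE; case: eqP => [->|].
have Qs x : Q (shift d x) = Q x.
  by apply: eq_forallb => j; rewrite ffunE; case: (j == d).
have -> : \sum_(x | base S x) h (shift d x) = \sum_(x | Q x && (x d != ord0)) h x.
  rewrite [RHS](reindex_inj (@shift_inj d)) /=; apply: eq_bigl => x.
  by rewrite baseQ Qs ffunE eqxx ordS_eq0.
have -> : \sum_(x | base S x) h x = \sum_(x | Q x) h x.
  rewrite [RHS](bigID (fun x => x d == ord_max)) /= [X in _ = X + _]big1 ?add0r.
    by apply: eq_bigl => x; rewrite baseQ.
  by move=> x /andP[_ /eqP /hN].
rewrite (bigID (fun x => x d == ord0) Q) /=.
rewrite addrCA addrr_bool addr0.
by apply: eq_bigl => x; rewrite baseD.
Qed.

(* The cochain below is the coboundary of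
   [phi a \cup d(phi b) \cup ...], so its sum over the box telescopes to a sum
   over the faces, where only the face [x a = 0] contributes. *)
Lemma sum_cup L S : uniq L -> S =i L ->
  \sum_(x | base S x) cup shift (phis L) S x = 1.
Proof.
elim: L S => [|a L IH] S.
  move=> _ S0; rewrite (big_pred1 [ffun=> ord0]) //= => x.
  apply/forallP/eqP => [H | -> j]; last by rewrite S0 ffunE.
  by apply/ffunP => j; rewrite ffunE; have := H j; rewrite S0 => /eqP.
move=> /= /andP[aL uL] SaL.
have aS : a \in S by rewrite SaL mem_head.
pose h d x := phi a x * cup shift (phis L) (S :\ d) x.
transitivity (\sum_(d in S)
   (\sum_(x | base S x) h d (shift d x) + \sum_(x | base S x) h d x)).
  transitivity (\sum_(d in S) \sum_(x | base S x) (h d (shift d x) + h d x)).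
    rewrite [RHS]exchange_big; apply: eq_bigr => x _ /=.
    rewrite [RHS]big_split /=.
    (* Closedness replaces the back facets by the front ones in the terms with factor [phi a x],
       which makes them values of [h d] at [x]. *)
    rewrite -[X in _ = _ + X]mulr_sumr -(cup_closed shiftC) mulr_sumr -big_split.
    by apply: eq_bigr => d _; rewrite mulrDl.
  by apply: eq_bigr => d _; rewrite big_split.
transitivity (\sum_(d in S) \sum_(x | base (S :\ d) x) h d x).
  apply: eq_bigr => d dS; apply: sum_shift => // y yd; rewrite /h.
  move: dS; rewrite SaL inE => /predU1P[<-|dL]; first by rewrite phiN ?mul0r.
  by rewrite (cup_face dL) ?mulr0 ?setD11 //; right.
rewrite (bigD1 a) //= [X in _ + X]big1 ?addr0.
  rewrite -[RHS](IH (S :\ a)) //; last first.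
    move=> j; rewrite !inE SaL inE; case: eqP => //= ->.
    by rewrite (negbTE aL).
  apply: eq_bigr => x /forallP /(_ a); rewrite setD11 => /eqP xa.
  by rewrite /h phi0 ?mul1r.
move=> d /andP[dS da]; apply: big1 => x /forallP /(_ d); rewrite setD11 => /eqP xd.
move: dS; rewrite SaL inE (negbTE da) /= => dL.
by rewrite /h (cup_face dL) ?mulr0 ?setD11 //; left.
Qed.

(** A nonzero sum has a nonzero term, that is, an edge path on which each label in [L] changes along
    its own step; the ends of that step are the two vertices. *)
Lemma cup_neq0 L S x : cup shift (phis L) S x != 0 ->
  forall a, a \in L -> exists y z,
    [/\ near_base S x y, near_base S x z, phi a y & ~~ phi a z].
Proof.
elim: L S x => // b L IH S x /= H a.
have [d /andP[dS]] : exists d, (d \in S) &&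
    ((phi b (shift d x) + phi b x) * cup shift (phis L) (S :\ d) (shift d x) != 0).
  apply/existsP; apply: contraNT H => /existsPn H; rewrite big1 // => d dS.
  by have := H d; rewrite dS /= negbK => /eqP.
rewrite mulf_eq0 negb_or => /andP[Hb Hc].
have near_x : near_base S x x by move=> j; left.
have near_s : near_base S x (shift d x).
  by move=> j; rewrite ffunE; case: eqP => [->|_]; [right; rewrite dS /= | left].
rewrite inE => /predU1P[->|/(IH _ _ Hc)[y [z [ny nz py pz]]]].
  case: (boolP (phi b x)) Hb => px; case: (boolP (phi b (shift d x))) => ps // _.
    by exists x, (shift d x).
  by exists (shift d x), x.
have tr w : near_base (S :\ d) (shift d x) w -> near_base S x w.
  move=> nw j; have := nw j; rewrite !inE !ffunE.
  case: eqP => [->|_] /=; last by [].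
  by case=> // ->; right; rewrite dS /=.
by exists y, z; split=> //; exact: tr.
Qed.

Lemma discrete_poincare_miranda : exists x, base [set: 'I_m]%SET x /\
  forall a, exists y z,
    [/\ near_base [set: 'I_m]%SET x y, near_base [set: 'I_m]%SET x z,
        phi a y & ~~ phi a z].
Proof.
have sum1 : \sum_(x | base [set: 'I_m]%SET x)
    cup shift (phis (enum 'I_m)) [set: 'I_m]%SET x = 1.
  by apply: sum_cup; [exact: enum_uniq | move=> j; rewrite mem_enum inE].
have /existsP[x /andP[bx /cup_neq0 H]] : [exists x, base [set: 'I_m]%SET x &&
    (cup shift (phis (enum 'I_m)) [set: 'I_m]%SET x != 0)].
  apply: contraPT sum1 => /existsPn H0; rewrite big1 // => x bx.
  by have := H0 x; rewrite bx /= negbK => /eqP.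
by exists x; split=> // a; apply: H; rewrite mem_enum.
Qed.

End grid.

(** * Complementarity problems for continuous maps *)

Section complementarity.
Variables (R : realType) (m : nat).
Implicit Types p q : 'I_m -> R.

(** Compactness of the box, obtained through row vectors and stated coordinatewise. *)
Lemma box_cluster (L : R) (q : nat -> 'I_m -> R) :
    (forall k j, 0 <= q k j <= L) ->
  exists p, (forall j, 0 <= p j <= L) /\
    forall (e : R) K, 0 < e -> exists k, (K <= k)%N /\ forall j, `|q k j - p j| < e.
Proof.
move=> q0L.
have cA := @rV_compact R m (fun=> `[0, L]%classic) (fun=> @segment_compact R 0 L).
have [|p [/= p0L clp]] := cA ((fun k => \row_j q k j) @ \oo) (fmap_proper_filter _ _).
  by exists 0%N => // k _ j; rewrite /= mxE in_itv /= q0L.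
exists (fun j => p ord0 j); split; first by move=> j; have := p0L j; rewrite /= in_itv.
move=> e K e0.
have [|| _ [[k Kk <-] /= pk]] := clp [set \row_j q k j | k in [set k | (K <= k)%N]] (ball p e).
- by exists K => // k /= Kk; exists k.
- exact: nbhsx_ballx.
exists k; split=> // j; case: pk => _ /(_ ord0 j).
by rewrite /ball /= mxE distrC.
Qed.

(** The discrete theorem gives cubes of ever finer grids on which every label takes both values. At
    a cluster point of their corners, vertices labelled 0 force [f j p <= 0], and those labelled 1
    force [0 <= f j p] unless they lie on the face at price 0. *)
Lemma complementarity (L : R) (f : 'I_m -> ('I_m -> R) -> R) :
    0 < L ->
    (forall j p (e : R), (forall k, 0 <= p k) -> 0 < e -> exists2 d : R, 0 < d &
       forall q, (forall k, 0 <= q k) -> (forall k, `|q k - p k| < d) ->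
       `|f j q - f j p| < e) ->
    (forall j p, (forall k, 0 <= p k) -> p j = L -> f j p <= 0) ->
  exists p, (forall j, 0 <= p j) /\
    forall j, f j p <= 0 /\ (0 < p j -> 0 <= f j p).
Proof.
move=> L0 fcont fL.
(* The mesh is [L / k.+1], so [ord_max] is sent exactly to [L]. *)
pose pt k (x : {ffun 'I_m -> 'I_k.+2}) (j : 'I_m) : R := L * (x j)%:R / k.+1%:R.
have pt_ge0 k x j : 0 <= @pt k x j.
  by rewrite /pt divr_ge0 ?mulr_ge0 ?ler0n // ltW.
(* The first disjunct forces label 1 on the lower face; the sign of [f] at [L] gives label 0 on the
   upper one. *)
pose phi k (j : 'I_m) (x : {ffun 'I_m -> 'I_k.+2}) := (x j == ord0) || (0 < f j (@pt k x)).
have exx : forall k, exists x, base [set: 'I_m]%SET x /\ forall a, exists y z,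
    [/\ near_base [set: 'I_m]%SET x y, near_base [set: 'I_m]%SET x z,
        phi k a y & ~~ phi k a z].
  move=> k; apply: discrete_poincare_miranda => j x xj; rewrite /phi xj; first by rewrite eqxx.
  have -> : (ord_max == ord0 :> 'I_k.+2) = false by [].
  rewrite /= ltNge fL //; by rewrite /pt xj mulfK ?pnatr_eq0.
pose x k := sval (cid (exx k)).
have Hx k := svalP (cid (exx k)).
have near_pt k y : near_base [set: 'I_m]%SET (x k) y ->
    forall j, `|pt k y j - pt k (x k) j| <= L / k.+1%:R.
  move=> ny j; have k0 : (0 : R) < k.+1%:R by rewrite ltr0n.
  rewrite /pt; case: (ny j) => [->|/andP[_ /eqP ->]].
    by rewrite subrr normr0 divr_ge0 // ltW.
  have /forallP/(_ j) := (Hx k).1; rewrite inE -val_eqE /= => xN.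
  have ltx : ((x k j).+1 < k.+2)%N by rewrite ltn_neqAle ltnS xN /= -ltnS.
  rewrite modn_small // -mulrBl -mulrBr -[_.+1]addn1 natrD addrAC subrr add0r mulr1.
  by rewrite ger0_norm // divr_ge0 // ltW.
have [|p [p0L clp]] := @box_cluster L (fun k => pt k (x k)).
  move=> k j; rewrite pt_ge0 /= /pt -mulrA ler_piMr ?(ltW L0) //.
  by rewrite ler_pdivrMr ?ltr0n // mul1r ler_nat -ltnS.
exists p; have p0 j : 0 <= p j by have /andP[] := p0L j.
split=> // j.
have close (d : R) : 0 < d -> exists k, forall y,
    near_base [set: 'I_m]%SET (x k) y -> forall j, `|pt k y j - p j| < d.
  move=> d0; have d20 : 0 < d / 2 by rewrite divr_gt0.
  (* From this bound on, the mesh is at most [d / 2]. *)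
  have [k [Kk pk]] := clp (d / 2) (Num.bound (L / (d / 2))) d20.
  exists k => y ny i; rewrite -(subrKA (pt k (x k) i)).
  rewrite (le_lt_trans (ler_normD _ _)) // (splitr d) ler_ltD //.
  rewrite (le_trans (near_pt _ _ ny i)) // ler_pdivrMr ?ltr0n // mulrC.
  rewrite -ler_pdivrMr //; apply/ltW/(lt_le_trans (archi_boundP _)).
    by rewrite divr_ge0 // ltW.
  by rewrite ler_nat (leq_trans Kk).
split.
  rewrite leNgt; apply/negP => fp.
  have [d d0 Hd] := fcont j p _ p0 fp.
  have [k Hk] := close _ d0.
  have [_ [z [_ nz _]]] := (Hx k).2 j.
  have := Hd _ (pt_ge0 k z) (Hk _ nz); rewrite negb_or ltr_distl => /andP[? _] /andP[_ /negP]; apply.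
  lra.
move=> pj; rewrite leNgt; apply/negP => fp.
have [|d d0 Hd] := fcont j p (- f j p) p0; first by rewrite oppr_gt0.
(* Being closer than [p j] keeps the vertex off the face at price 0, so its label 1 comes from the
   sign of [f j]. *)
have [|k Hk] := close (Num.min d (p j)); first by rewrite lt_min d0.
have [y [_ [ny _ + _]]] := (Hx k).2 j.
have Hy i : `|pt k y i - p i| < d.
  by have := Hk _ ny i; rewrite lt_min => /andP[].
have := Hd _ (pt_ge0 k y) Hy; rewrite ltr_distl => /andP[_ +] /orP[/eqP yj|].
  have := Hk _ ny j; rewrite /pt yj /= mulr0 mul0r sub0r normrN lt_min => /andP[_].
  by rewrite ger0_norm ?ltxx // ltW.
lra.
Qed.

End complementarity.

(** * Continuity of the sale probabilities *)

Lemma measurable_forall_fin d (X : measurableType d) (I : finType)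
    (P : I -> set X) :
  (forall i, measurable (P i)) -> measurable [set x | forall i, P i x].
Proof.
move=> mP; rewrite (_ : [set _ | _] = \bigcap_(i in [set: I]) P i).
  by apply: fin_bigcap_measurable.
by apply/seteqP; split=> x /= H i; [move=> _; exact: H | exact: H].
Qed.

Lemma measurable_exists_fin d (X : measurableType d) (I : finType)
    (P : I -> set X) :
  (forall i, measurable (P i)) -> measurable [set x | exists i, P i x].
Proof.
move=> mP; rewrite (_ : [set _ | _] = \bigcup_(i in [set: I]) P i).
  by apply: fin_bigcup_measurable.
by apply/seteqP; split=> x /= [i]; [exists i | move=> _; exists i].
Qed.

Lemma measurable_imply d (X : measurableType d) (b : bool) (P : set X) :
  measurable P -> measurable [set x | b -> P x].
Proof.
case: b => mP.
  by rewrite (_ : [set _ | _] = P) //; apply/seteqP; split=> x /= H; [exact: H|].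
by rewrite (_ : [set _ | _] = setT) //; apply/seteqP; split.
Qed.

Lemma measurable_and d (X : measurableType d) (b : bool) (P : set X) :
  measurable P -> measurable [set x | b /\ P x].
Proof.
case: b => mP.
  by rewrite (_ : [set _ | _] = P) //; apply/seteqP; split=> x //= [].
by rewrite (_ : [set _ | _] = set0) //; apply/seteqP; split=> x // [].
Qed.

Lemma probability1_forall_fin d (X : measurableType d) (R : realType)
    (D : probability X R) (I : finType) (P : I -> set X) :
    (forall i, measurable (P i)) -> (forall i, D (P i) = 1%E) ->
  D [set x | forall i, P i x] = 1%E.
Proof.
move=> mP P1; have mA := measurable_forall_fin mP.
have aeP i : {ae D, forall x, P i x}.
  apply/(negligibleP D (measurableC (mP i))).
  by rewrite [LHS]probability_setC // P1 subee.
have /(negligibleP D (measurableC mA)) H : {ae D, forall x, forall i, P i x} by exact: filter_forall.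
rewrite -[X in D X]setCK probability_setC; last exact: measurableC.
by rewrite H ?sube0 //; exact: measurableC.
Qed.

Section sale.
Context {R : realType} {n m : nat}.
Implicit Types (p q : 'I_m -> R) (M B C : {set 'I_m}) (w : valuation R m)
  (v : profile R n m).

(** * Margins of demanded sets and stability of the sale *)

Lemma measurable_value B : measurable_fun setT (fun w : valuation R m => w B).
Proof.
move=> _ Y mY; rewrite setTI; apply: sub_sigma_algebra.
by exists B => //; exists Y => //; rewrite setTI.
Qed.

Lemma measurable_utility p B :
  measurable_fun setT (fun w : valuation R m => utility w p B).
Proof.
by apply: measurable_funB; [exact: measurable_value | exact: measurable_cst].
Qed.

(** For [d = 0] this is uniqueness of the demanded set; a positive [d] makes it robust against price
    changes. *)
Definition gap w p M (d : R) B : Prop :=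
  B \subset M /\ forall C, C \subset M -> C != B ->
    utility w p C + d < utility w p B.

Lemma measurable_gap p M d B : measurable [set w | gap w p M d B].
Proof.
apply: measurable_and; apply: measurable_forall_fin => C.
do 2 apply: measurable_imply.
rewrite -[X in measurable X]setTI.
have := @measurable_fun_ltr _ _ R setT
  (fun w : valuation R m => utility w p C + d) (fun w => utility w p B).
move=> /(_ _ _ measurableT [set true]); rewrite preimage_true; apply => //.
  by apply: measurable_funD; [exact: measurable_utility|exact: measurable_cst].
exact: measurable_utility.
Qed.

Lemma gap_demand w p M B : gap w p M 0 B -> demand w p M = [set B]%SET.
Proof.
case=> BM H; apply/setP => C; rewrite !inE; apply/andP/eqP => [[CM]|->].
  move=> /forallP/(_ B); rewrite BM /= => uBC; apply/eqP.
  apply: contraLR uBC => CB; rewrite -ltNge.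
  by have := H _ CM CB; rewrite addr0.
split=> //; apply/forallP => C'; apply/implyP => C'M.
have [->//|C'B] := eqVneq C' B; apply: ltW.
by have := H _ C'M C'B; rewrite addr0.
Qed.

Lemma demand_gap w p M : #|demand w p M| = 1%N -> exists B, gap w p M 0 B.
Proof.
move=> /eqP/cards1P[B DB]; have : B \in demand w p M by rewrite DB set11.
rewrite inE => /andP[BM /forallP maxB]; exists B; split=> // C CM CB.
rewrite addr0 lt_neqAle (implyP (maxB C)) // andbT.
apply: contraNneq CB => uCB; suff : C \in demand w p M by rewrite DB finset.inE.
by rewrite inE CM; apply/forallP => C'; rewrite uCB.
Qed.

Lemma gap_le w p M B d d' : d' <= d -> gap w p M d B -> gap w p M d' B.
Proof.
move=> d'd [BM H]; split=> // C CM CB; apply: le_lt_trans (H _ CM CB).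
by rewrite lerD2l.
Qed.

Lemma utility_near w p q (d : R) C : 0 <= d -> (forall j, `|q j - p j| <= d) ->
  `|utility w q C - utility w p C| <= m%:R * d.
Proof.
move=> d0 pq; have -> : utility w q C - utility w p C = \sum_(j in C) (p j - q j).
  by rewrite sumrB /utility; ring.
rewrite (le_trans (ler_norm_sum _ _ _)) //.
apply: (@le_trans _ _ (\sum_(j in C) d)).
  by apply: ler_sum => j _; rewrite distrC.
rewrite sumr_const -[X in X <= _]mulr_natl.
by rewrite ler_wpM2r // ler_nat -[X in (_ <= X)%N]card_ord max_card.
Qed.

(** Each of the two compared utilities moves by at most [m * d], hence the factor 2. *)
Lemma gap_near w p q M B (d : R) : 0 <= d -> (forall j, `|q j - p j| <= d) ->
  gap w p M (m%:R * d *+ 2) B -> gap w q M 0 B.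
Proof.
move=> d0 pq [BM H]; split=> // C CM CB; have := H _ CM CB.
have := utility_near w B d0 pq; have := utility_near w C d0 pq.
rewrite !ler_norml mulr2n => /andP[? ?] /andP[? ?] ?; lra.
Qed.

(** Asking for all [M], not only the sets left over in a sale, makes the event independent of the
    run. *)
Definition uniform_gap p (d : R) : set (profile R n m) :=
  [set v | forall i M, exists B, gap (agent i v) p M d B].

Lemma measurable_uniform_gap p d : measurable (uniform_gap p d).
Proof.
apply: measurable_forall_fin => i; apply: measurable_forall_fin => M.
apply: measurable_exists_fin => B.
have := @measurable_agent R n m i measurableT _ (measurable_gap p M d B).
by rewrite setTI.
Qed.

Lemma uniform_gap_sold p q (d : R) j v : (forall k, `|q k - p k| <= d) ->
  uniform_gap p (m%:R * d *+ 2) v -> sold q j v <-> sold p j v.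
Proof.
move=> pq gv.
have d0 : 0 <= d by exact: le_trans (pq j).
have m2d : 0 <= m%:R * d *+ 2 by rewrite mulrn_wge0 // mulr_ge0.
have eqD i M : demand (agent i v) q M = demand (agent i v) p M.
  have [B gB] := gv i M.
  by rewrite (gap_demand (gap_near d0 pq gB)) (gap_demand (gap_le m2d gB)).
by split=> -[X sX jX]; exists X => // i; [rewrite -eqD|rewrite eqD]; exact: sX.
Qed.

Lemma measurable_demand p M B i :
  measurable [set v : profile R n m | B \in demand (agent i v) p M].
Proof.
rewrite (_ : [set _ | _] =
   [set v | B \subset M /\ forall C, C \subset M ->
     utility (agent i v) p C <= utility (agent i v) p B]).
  apply: measurable_and; apply: measurable_forall_fin => C.
  apply: measurable_imply; rewrite -[X in measurable X]setTI.
  by apply: measurable_fun_le => //;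
    apply: measurableT_comp (measurable_utility _ _) (measurable_agent _).
apply/seteqP; split=> v /=; rewrite inE.
  by move=> /andP[-> /forallP H]; split=> // C; exact/implyP.
by move=> [-> H]; apply/forallP => C; apply/implyP/H.
Qed.

(** Runs are recoded as finite functions, so that the existential ranges over a finite type. *)
Lemma measurable_sold p j : measurable (sold (n := n) p j).
Proof.
rewrite (_ : sold p j = [set v | exists X : {ffun 'I_n -> {set 'I_m}},
   [exists i, j \in X i] /\ sale v p X]).
  apply: measurable_exists_fin => X; apply: measurable_and.
  by apply: measurable_forall_fin => i; exact: measurable_demand.
apply/seteqP; split=> v /=.
  case=> X sX [i ji]; exists (finfun X); split.
    by apply/existsP; exists i; rewrite ffunE.
  by rewrite (_ : finfun X = X :> (_ -> _)) //; apply/funext => k; rewrite ffunE.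
by case=> X [/existsP jX sX]; exists X.
Qed.

(** Buying nothing has utility 0, so a buyer's set is worth at least its total price. *)
Lemma sold_value p j v : (forall k, 0 <= p k) -> sold p j v ->
  exists i, p j <= agent i v [set: 'I_m]%SET.
Proof.
move=> p0 [X sX [i jX]]; exists i.
have := sX i; rewrite inE => /andP[_ /forallP/(_ finset.set0)].
rewrite finset.sub0set /= /utility value_set0 big_set0 subr0 subr_ge0 => le_v.
apply: (le_trans _ (value_mono _ (finset.subsetT (X i)))).
by apply: le_trans le_v; rewrite (bigD1 j) //= lerDl sumr_ge0.
Qed.

(** * Estimates for the sale probabilities *)

Variable D : probability (profile R n m) R.

(** Continuity of the measure from below. *)
Lemma exhaustion (F : (set (profile R n m))^nat) (e : R) :
    (forall k, measurable (F k)) -> nondecreasing_seq F ->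
    D (\bigcup_k F k) = 1%E -> 0 < e ->
  exists k, (D (~` F k) < e%:E)%E.
Proof.
move=> mF ndF F1 e0.
have mU : measurable (\bigcup_k F k) by exact: bigcupT_measurable.
have := nondecreasing_cvg_mu (mu := D) mF mU ndF; rewrite [X in _ --> X]F1.
move=> /fine_cvg /cvgr_gt /(_ (1 - e)) [|K _ /(_ K (leqnn K)) /= FK].
  by rewrite gtrBl.
exists K; rewrite probability_setC // -(fineK (fin_num_measure D _ (mF K))).
by rewrite -EFinB lte_fin ltrBlDl -ltrBlDr.
Qed.

Lemma le_measure_sold p q j (G : set (profile R n m)) : measurable G ->
    (forall v, G v -> sold p j v -> sold q j v) ->
  fine (D (sold p j)) <= fine (D (sold q j)) + fine (D (~` G)).
Proof.
move=> mG pq; have mp := measurable_sold p j; have mq := measurable_sold q j.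
have mC := measurableC mG.
rewrite -lee_fin EFinD !fineK ?fin_num_measure //.
apply: le_trans (measureU2 _ mq mC).
apply: le_measure; rewrite ?inE //; first exact: measurableU.
by move=> v sv; case: (pselect (G v)) => Gv; [left; exact: pq | right].
Qed.

Hypothesis hD : generic D.

Lemma generic_uniform_gap p : (forall j, 0 <= p j) -> D (uniform_gap p 0) = 1%E.
Proof.
move=> p0; have mgap i M : measurable
    [set v : profile R n m | exists B, gap (agent i v) p M 0 B].
  apply: measurable_exists_fin => B.
  have := @measurable_agent R n m i measurableT _ (measurable_gap p M 0 B).
  by rewrite setTI.
apply: probability1_forall_fin => i; first by apply: measurable_forall_fin => M; exact: mgap.
apply: probability1_forall_fin => M; first exact: mgap.
rewrite -[RHS](hD i M p0); congr (D _); apply/seteqP; split=> v /=.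
  by case=> B /gap_demand ->; rewrite cards1.
exact: demand_gap.
Qed.

(** Only finitely many margins are compared, so if all are positive they all exceed some
    [k.+1%:R^-1]. *)
Lemma bigcup_uniform_gap p :
  \bigcup_k uniform_gap p k.+1%:R^-1 = uniform_gap p 0.
Proof.
apply/seteqP; split=> v /=.
  move=> [k _ gv] i M; have [B gB] := gv i M; exists B.
  by apply: gap_le gB; rewrite invr_ge0.
move=> gv; suff [K _ /(_ K (leqnn K)) /= gK] :
  \forall k \near \oo, uniform_gap p k.+1%:R^-1 v by exists K.
apply: filter_forall => i; apply: filter_forall => M.
have [B [BM H]] := gv i M.
suff : \forall k \near \oo, forall C, C \subset M -> C != B ->
    utility (agent i v) p C + k.+1%:R^-1 < utility (agent i v) p B.
  by apply: filterS => k Hk; exists B.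
apply: filter_forall => C.
case: (boolP ((C \subset M) && (C != B))) => [/andP[CM CB]|nC]; last first.
  by apply: nearW => k CM CB; rewrite CM CB in nC.
have d0 : 0 < utility (agent i v) p B - utility (agent i v) p C.
  by rewrite subr_gt0 -[X in X < _]addr0 H.
have := near_infty_natSinv_lt (PosNum d0); apply: filterS => k /= kd _ _.
by rewrite -ltrBrDl.
Qed.

Lemma sale_probability_continuous j p (e : R) : (forall k, 0 <= p k) -> 0 < e ->
  exists2 d : R, 0 < d & forall q, (forall k, `|q k - p k| < d) ->
    `|fine (D (sold q j)) - fine (D (sold p j))| < e.
Proof.
move=> p0 e0; pose F k := uniform_gap p k.+1%:R^-1.
have mF k : measurable (F k) by exact: measurable_uniform_gap.
have [||K FK] := exhaustion mF _ _ e0.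
- move=> k l kl; apply/subsetPset => v gv i M; have [B gB] := gv i M.
  by exists B; apply: gap_le gB; rewrite lef_pV2 ?posrE ?ltr0n // ler_nat.
- by rewrite bigcup_uniform_gap generic_uniform_gap.
(* Chosen so that the loss [2 * m * d] stays within the margin [K.+1%:R^-1]; the successor keeps the
   denominator positive. *)
pose d : R := K.+1%:R^-1 / (m.*2.+1)%:R.
have d0 : 0 < d by rewrite divr_gt0 ?invr_gt0 ?ltr0n.
exists d => // q pq.
have md : m%:R * d *+ 2 <= K.+1%:R^-1.
  rewrite -mulrnAl -mulrnA muln2 /d mulrA ler_pdivrMr ?ltr0n // mulrC.
  by rewrite ler_pM2l ?invr_gt0 ?ltr0n // ler_nat.
have eq_sold v : F K v -> sold q j v <-> sold p j v.
  move=> Fv; apply: (uniform_gap_sold (d := d)) => [k|i M].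
    exact: ltW.
  by have [B gB] := Fv i M; exists B; apply: gap_le gB.
have le_pq := le_measure_sold (mF K) (fun v Fv => (eq_sold v Fv).1).
have le_qp := le_measure_sold (mF K) (fun v Fv => (eq_sold v Fv).2).
have {}FK : fine (D (~` F K)) < e.
  by rewrite -lte_fin fineK // fin_num_measure //; exact: measurableC.
rewrite ltr_distl; apply/andP; split; lra.
Qed.

(** Values are finite, so some [K] bounds every agent's value of all items outside an event of
    probability below 1/2; a sale at a higher price happens only on that event. *)
Lemma high_price : exists2 L : R, 0 < L & forall j p, (forall k, 0 <= p k) ->
  p j = L -> fine (D (sold p j)) <= 1 / 2.
Proof.
pose F k : set (profile R n m) :=
  [set v | forall i, agent i v [set: 'I_m]%SET <= k%:R].
have mF k : measurable (F k).
  apply: measurable_forall_fin => i; rewrite -[X in measurable X]setTI.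
  apply: measurable_fun_le => //.
  exact: measurableT_comp (measurable_value _) (measurable_agent _).
have [|||K FK] := @exhaustion F (1 / 2) mF.
- move=> k l kl; apply/subsetPset => v Fv i; apply: le_trans (Fv i) _.
  by rewrite ler_nat.
- rewrite (_ : \bigcup_k F k = setT) ?probability_setT //.
  apply/seteqP; split=> // v _; suff [K _ /(_ K (leqnn K)) FK] :
    \forall k \near \oo, F k v by exists K.
  apply: filter_forall => i.
  exists (Num.bound (agent i v [set: 'I_m]%SET)) => // k /= lek.
  apply/ltW/(lt_le_trans (archi_boundP (value_ge0 _ _))).
  by rewrite ler_nat.
- by rewrite divr_gt0.
(* The successor makes the price strictly exceed the bound [K], and positive. *)
exists K.+1%:R => [|j p p0 pj]; first by rewrite ltr0n.
apply/ltW; rewrite -lte_fin fineK ?fin_num_measure //; last exact: measurable_sold.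
apply: le_lt_trans FK; apply: le_measure; rewrite ?inE //.
- exact: measurable_sold.
- exact: measurableC.
move=> v /(sold_value p0)[i]; rewrite pj => lev Fv.
by have := le_trans lev (Fv i); rewrite ler_nat ltnn.
Qed.

End sale.

Theorem theorem4p4 (R : realType) (n m : nat) (hn : (1 <= n)%N) (hm : (1 <= m)%N)
    (D : probability (profile R n m) R) (hD : generic D) :
  exists p : 'I_m -> R, half_median_prices D p.
Proof.
have [L L0 HL] := high_price D.
(* The two complementarity conditions for [pi_j - 1/2] are the two median conditions. *)
have [|j p pge0 pj|p [p0 Hp]] :=
    @complementarity R m L (fun j p => fine (D (sold p j)) - 1 / 2) L0.
- move=> j p e p0 e0.
  have [d d0 Hd] := sale_probability_continuous hD j p0 e0.
  by exists d => // q _ /Hd; rewrite opprB addrA subrK.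
- by rewrite subr_le0 HL.
have fin j : D (sold p j) \is a fin_num.
  by rewrite fin_num_measure //; exact: measurable_sold.
exists p; split=> // j; rewrite /sale_probability -(fineK (fin j)) lee_fin.
  by rewrite -subr_le0; exact: (Hp j).1.
by rewrite -subr_ge0; exact: (Hp j).2.
Qed.
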